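(* Let $k\ge 1$, $\delta\in\Delta_k$ and $n\ge 1$. Let $\Delta_\delta(n)$ be the set of all $\delta'\in\Delta(n)$ possessing a cycle of shape $\delta$. Then $$\|\Delta_\delta(n)\|=\frac{1}{2^k+1}\left(2^n-2^\ell(-1)^{[n/k]}\right),$$ where $0\le \ell<k$ satisfies $n\equiv\ell \pmod k$, and $[x]$ denotes the greatest integer not more than $x$.
   Context: Let $I_n=\{1,2,\ldots,n\}$. A permutation $\delta$ of $I_n$ is unimodal if there is $m\in I_n$ such that $a<b\le m$ implies $\delta(a)<\delta(b)$, and $m\le a<b$ implies $\delta(a)>\delta(b)$. $\Delta(n)$ is the set of unimodal permutations of $I_n$, and $\Delta_n\subset\Delta(n)$ is the set of those consisting of a single $n$-cycle. $\|X\|$ denotes the cardinality of $X$. For a finite set $J\subset\mathbb{R}$ with $k$ elements, $\Omega_J:I_k\to J$ is the unique increasing bijection. If $\delta'\in\Delta(n)$ and $J\subseteq I_n$ is the underlying set of one of the disjoint cycles of $\delta'$ (fixed points count as cycles of length 1), then the shape of the cycle $\delta'|_J$ is $\Omega_J^{-1}\circ\delta'\circ\Omega_J\in\Delta_{\|J\|}$. *)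

(* Defs.v *)
From mathcomp Require Import all_boot all_fingroup.

Set Implicit Arguments.
Unset Strict Implicit.
Unset Printing Implicit Defensive.

(* I_n = {1, ..., n} is represented by 'I_n = {0, ..., n - 1}; every notion   *)
(* below depends only on the order of I_n.                                    *)

Definition unimodal (n : nat) (s : 'S_n) : bool :=
  [exists m : 'I_n, forall a : 'I_n, forall b : 'I_n,
     ((a < b <= m) ==> (s a < s b)) && ((m <= a < b) ==> (s b < s a))].

Definition Delta (n : nat) : {set 'S_n} := [set s | unimodal s].

Definition DeltaCyc (n : nat) : {set 'S_n} :=
  [set s in Delta n | porbits s == [set [set: 'I_n]]].

(* The increasing bijection from I_#|J| onto J: enum J lists J in increasing  *)
(* order, see OmegaP.                                                         *)
Definition Omega (n : nat) (J : {set 'I_n}) : 'I_#|J| -> 'I_n :=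
  fun i => enum_val i.

(* restr_perm J s agrees with s on J when s stabilizes J (in particular when  *)
(* J is an orbit of s) and is the identity otherwise. On J, enum_rank_in is   *)
(* the inverse of Omega J.                                                    *)
Definition shape_fun (n : nat) (s : 'S_n) (J : {set 'I_n}) : 'I_#|J| -> 'I_#|J| :=
  fun i => enum_rank_in (enum_valP i) (restr_perm J s (Omega i)).

Lemma Omega_shape_fun (n : nat) (s : 'S_n) (J : {set 'I_n}) (i : 'I_#|J|) :
  Omega (shape_fun s i) = restr_perm J s (Omega i).
Proof.
rewrite /Omega /shape_fun enum_rankK_in //.
by rewrite (perm_closed _ (restr_perm_on J s)) enum_valP.
Qed.

Lemma shape_fun_inj (n : nat) (s : 'S_n) (J : {set 'I_n}) :
  injective (@shape_fun n s J).
Proof.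
move=> i j /(congr1 (@Omega n J)); rewrite !Omega_shape_fun.
by move/perm_inj/enum_val_inj.
Qed.

Definition cycle_shape (n : nat) (s : 'S_n) (J : {set 'I_n}) : 'S_#|J| :=
  perm (@shape_fun_inj n s J).

(* Equality in the total space {k & 'S_k} says that #|J| = k and that the     *)
(* shape of J is d.                                                           *)
Definition has_cycle_of_shape (n k : nat) (s : 'S_n) (d : 'S_k) : bool :=
  [exists J in porbits s,
     Tagged (fun k => 'S_k) (cycle_shape s J) == Tagged (fun k => 'S_k) d].

Definition DeltaShape (k : nat) (d : 'S_k) (n : nat) : {set 'S_n} :=
  [set s in Delta n | has_cycle_of_shape s d].

Lemma OmegaP (n : nat) (J : {set 'I_n}) :
  {mono @Omega n J : i j / (i < j)%N} /\ (forall x, x \in J <-> exists i : 'I_#|J|, Omega i = x).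
Proof.
split; last first.
  move=> x; split=> [xJ|[i <-]]; last exact: enum_valP.
  by exists (enum_rank_in xJ x); rewrite /Omega enum_rankK_in.
have srt : sorted ltn (map val (enum J)).
  rewrite {1}/enum_mem -enumT; apply: (subseq_sorted ltn_trans (s2 := iota 0 n)).
    rewrite -val_enum_ord; apply: map_subseq; exact: filter_subseq.
  exact: iota_ltn_sorted.
have homo (i j : 'I_#|J|) : i < j -> Omega i < Omega j.
  move=> lij; have x0 := Omega i; rewrite /Omega !(enum_val_nth x0).
  have sz k : k < #|J| -> k < size (enum J) by rewrite -cardE.
  rewrite -!(nth_map x0 0 val) ?sz //.
  by apply: (sorted_ltn_nth ltn_trans) => //; rewrite inE size_map -cardE.
move=> i j; case: (ltngtP i j) => [/homo //|/homo /ltnW|/val_inj ->]; last by rewrite ltnn.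
by rewrite leqNgt => /negbTE.
Qed.

Lemma Omega_cycle_shape (n : nat) (s : 'S_n) (J : {set 'I_n}) (i : 'I_#|J|) :
  J \in porbits s -> Omega (cycle_shape s J i) = s (Omega i).
Proof.
move=> /imsetP[x _ JE]; rewrite permE Omega_shape_fun restr_permE ?enum_valP //.
apply/astabsP => y; rewrite /= /aperm JE -!eq_porbit_mem.
by have /eqP <- : porbit s y == porbit s (s y)
  by rewrite eq_porbit_mem porbit_sym (mem_porbit s 1).
Qed.

(* Main.v *)
(**
A pair (s, j) with s increasing on [0, j) and decreasing on [j, n) is a
unimodal permutation with one of its two cuts; there are 2^n such pairs, one
for each set s([0, j)).  Record for a point x its itinerary: the sequence of
sides (left or right of the cut) visited by its orbit.  Points are ordered by
their itineraries for the parity-twisted lexicographic order, and (s, j) is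
determined by the multiplicity with which each periodic 0-1 word occurs; every
shift-invariant multiplicity function m of total n occurs.

A k-cycle d has two cuts, one with an even and one with an odd number of points
on the right.  Let aE, aO be the corresponding itineraries of its least point
and mE, mO its multiplicity functions.  Then (s, j) has a cycle of shape d iff
m >= mE or m(aO) is odd.  Adding mE identifies all pairs of size n with the pairs
of size n + k satisfying m >= mE, and adding mO identifies the pairs of size n
without a cycle of shape d with the remaining pairs of size n + k having one.
Hence g(n + k) = 2^n + (2^n - g(n)) for the number g of pairs with a cycle of
shape d, from which the closed formula follows by induction.
*)
Require Import Defs.
From mathcomp Require Import all_boot all_order all_fingroup all_algebra.
From mathcomp Require Import cyclic zify ring.

Set Implicit Arguments.
Unset Strict Implicit.
Unset Printing Implicit Defensive.

(** * Parity-twisted order on periodic words *)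

(* The rank of the prefix [a 0 ... a (M - 1)] in the parity-twisted              *)
(* lexicographic order: a leading [true] reverses the order of the tails.       *)
Fixpoint key (M : nat) (a : nat -> bool) : nat :=
  if M is M'.+1 then
    let r := key M' (fun i => a i.+1) in if a 0 then 2 ^ M - r.+1 else r
  else 0.

Lemma eq_key M a b : a =1 b -> key M a = key M b.
Proof.
elim: M a b => //= M IHM a b ab.
by rewrite ab (IHM _ (fun i => b i.+1)) // => i; rewrite ab.
Qed.

Lemma key_bound M a : key M a < 2 ^ M.
Proof.
elim: M a => //= M IHM a; have := IHM (fun i => a i.+1).
by rewrite expnS; case: (a 0); lia.
Qed.

Lemma key_inj M a b : key M a = key M b -> forall i, i < M -> a i = b i.
Proof.
elim: M a b => //= M IHM a b.
have := key_bound M (fun i => a i.+1); have := key_bound M (fun i => b i.+1).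
rewrite expnS => hb ha.
case a0: (a 0); case b0: (b 0) => E; try lia; case=> [_|i iM]; rewrite ?a0 ?b0 //.
  by apply: (IHM (fun i => a i.+1) (fun i => b i.+1)) => //; lia.
by apply: (IHM (fun i => a i.+1) (fun i => b i.+1)).
Qed.

(** A strict comparison is settled at the first differing letter, so reading one more letter cannot
    change it. *)
Lemma key_ltS M a b : key M a < key M b -> key M.+1 a < key M.+1 b.
Proof.
elim: M a b => [//|M IHM] a b.
have IH := IHM (fun i => a i.+1) (fun i => b i.+1).
have IH' := IHM (fun i => b i.+1) (fun i => a i.+1).
have := key_bound M.+1 (fun i => a i.+1); have := key_bound M.+1 (fun i => b i.+1).
have := key_bound M (fun i => a i.+1); have := key_bound M (fun i => b i.+1).
rewrite -[key M.+2 _]/(if a 0 then 2 ^ M.+2 - (key M.+1 (fun i => a i.+1)).+1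
                       else key M.+1 (fun i => a i.+1)).
rewrite -[key M.+2 b]/(if b 0 then 2 ^ M.+2 - (key M.+1 (fun i => b i.+1)).+1
                       else key M.+1 (fun i => b i.+1)).
rewrite -[key M.+1 a]/(if a 0 then 2 ^ M.+1 - (key M (fun i => a i.+1)).+1
                       else key M (fun i => a i.+1)).
rewrite -[key M.+1 b]/(if b 0 then 2 ^ M.+1 - (key M (fun i => b i.+1)).+1
                       else key M (fun i => b i.+1)).
move: IH IH'; rewrite !expnS.
move: (key M.+1 _) (key M.+1 _) (key M _) (key M _) => p q r t.
by case: (a 0); case: (b 0); lia.
Qed.

Lemma eq_key_prefix M a b : (forall i, i < M -> a i = b i) -> key M a = key M b.
Proof.
elim: M a b => //= M IHM a b ab.
by rewrite ab // (IHM _ (fun i => b i.+1)) // => i iM; rewrite ab.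
Qed.

(** The last letter only breaks ties, so a common one is irrelevant. *)
Lemma key_leS M a b : a M = b M -> (key M.+1 a <= key M.+1 b) = (key M a <= key M b).
Proof.
move=> abM; case: (ltngtP (key M a) (key M b)) => [lt|lt|eq].
- by rewrite ltnW // key_ltS.
- by apply/negbTE; rewrite -ltnNge key_ltS.
rewrite (@eq_key_prefix M.+1 a b) ?leqnn // => i.
by rewrite ltnS leq_eqVlt => /predU1P[->|/(key_inj eq)].
Qed.

(** Each [true] letter reverses the order once; this tells whether [i] steps reverse it in total. *)
Fixpoint par (a : nat -> bool) (i : nat) : bool :=
  if i is i'.+1 then par a i' (+) a i' else false.

Lemma eq_par a b i : a =1 b -> par a i = par b i.
Proof. by move=> ab; elim: i => //= i ->; rewrite ab. Qed.

Lemma parD a i j : par a (i + j) = par a i (+) par (fun r => a (i + r)) j.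
Proof. by elim: j => [|j IHj]; rewrite ?addn0 ?addbF // addnS /= IHj addbA. Qed.

Lemma par_sum a i : par a i = odd (\sum_(r < i) a r).
Proof.
by elim: i => [|i IHi]; rewrite ?big_ord0 // big_ord_recr /= oddD oddb IHi.
Qed.

(** One period of a periodic sequence, which [letter] extends to all indices; the length is a
    successor so that [inord] applies. *)
Definition word (N' : nat) := {ffun 'I_N'.+1 -> bool}.

Section Words.

Variable N' : nat.
Local Notation N := N'.+1.
Local Notation word := (word N').

Definition letter (t : word) (i : nat) : bool := t (inord (i %% N)).
Definition shift (t : word) : word := [ffun i : 'I_N => letter t i.+1].
Definition unshift (t : word) : word := iter N' shift t.
Definition trunc (a : nat -> bool) : word := [ffun i : 'I_N => a i].

Lemma letter_inj t u : letter t =1 letter u -> t = u.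
Proof.
move=> tu; apply/ffunP => i; have := tu i.
by rewrite /letter modn_small ?ltn_ord // inord_val.
Qed.

Lemma letter_period t i : letter t (i + N) = letter t i.
Proof. by rewrite /letter modnDr. Qed.

Lemma letter_shift t i : letter (shift t) i = letter t i.+1.
Proof.
rewrite {1}/letter ffunE /letter inordK ?ltn_mod //; congr (t (inord _)).
by rewrite -addn1 modnDml addn1.
Qed.

Lemma letter_iter_shift r t i : letter (iter r shift t) i = letter t (r + i).
Proof.
by elim: r i => [|r IHr] i //; rewrite iterS letter_shift IHr addnS.
Qed.

Lemma shiftK : cancel shift unshift.
Proof.
move=> t; rewrite /unshift -iterSr; apply: letter_inj => i.
by rewrite letter_iter_shift addnC letter_period.
Qed.

Lemma unshiftK : cancel unshift shift.
Proof.
move=> t; rewrite /unshift -iterS; apply: letter_inj => i.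
by rewrite letter_iter_shift addnC letter_period.
Qed.

Lemma letter_trunc a : (forall i, a (i %% N) = a i) -> letter (trunc a) =1 a.
Proof. by move=> per i; rewrite /letter ffunE inordK ?ltn_mod. Qed.

Definition wle (t u : word) : bool := key N (letter t) <= key N (letter u).

Lemma wle_trans : transitive wle.
Proof. by move=> u t v; apply: leq_trans. Qed.

Lemma wle_total : total wle.
Proof. by move=> t u; apply: leq_total. Qed.

Lemma key_letter_inj t u : key N (letter t) = key N (letter u) -> t = u.
Proof.
move/key_inj => tu; apply: letter_inj => i.
by have := tu (i %% N); rewrite ltn_mod /letter modn_mod => ->.
Qed.

Lemma wle_anti : antisymmetric wle.
Proof. by move=> t u; rewrite /wle -eqn_leq => /eqP/key_letter_inj. Qed.

Lemma key_shift t :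
  key N (letter t) = let r := key N' (letter (shift t)) in
                     if letter t 0 then 2 ^ N - r.+1 else r.
Proof.
by rewrite /= (@eq_key _ (letter (shift t)) (fun i => letter t i.+1)) // => i;
  rewrite letter_shift.
Qed.

Lemma letter_shift_last t : letter (shift t) N' = letter t 0.
Proof. by rewrite letter_shift -[N'.+1]add0n letter_period. Qed.

Lemma wle_first t u : letter t 0 = false -> letter u 0 = true -> wle t u.
Proof.
move=> t0 u0; rewrite /wle !key_shift /= t0 u0 expnS.
have := key_bound N' (letter (shift t)); have := key_bound N' (letter (shift u)).
lia.
Qed.

(** Deleting the common first letter leaves tails of length [N']; the shifted words carry that
    letter at the end, where it cannot influence the comparison. A deleted [true] reverses the
    order. *)
Lemma wle_shift t u : letter t 0 = letter u 0 ->
  wle t u = if letter t 0 then wle (shift u) (shift t) else wle (shift t) (shift u).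
Proof.
move=> tu.
have l1 : letter (shift t) N' = letter (shift u) N' by rewrite !letter_shift_last.
rewrite /wle [key N (letter t)]key_shift [key N (letter u)]key_shift -tu /=.
rewrite -![if letter (shift _) 0 then _ else _]/(key N'.+1 (letter (shift _))).
rewrite !key_leS // expnS.
have := key_bound N' (letter (shift t)); have := key_bound N' (letter (shift u)).
case: (letter t 0); lia.
Qed.

End Words.

(** * Cuts and itineraries *)

Definition cut (n : nat) (s : 'S_n) (j : nat) : bool :=
  [forall a : 'I_n, forall b : 'I_n,
     ((a < b < j) ==> (s a < s b)) && ((j <= a < b) ==> (s b < s a))].

Lemma cutP n (s : 'S_n) j :
  reflect (forall a b : 'I_n, (a < b < j -> s a < s b) /\ (j <= a < b -> s b < s a))
          (cut s j).
Proof.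
apply: (iffP forallP) => [H a b|H a]; last first.
  by apply/forallP => b; have [H1 H2] := H a b; apply/andP; split; apply/implyP.
by have /forallP/(_ b)/andP[/implyP H1 /implyP H2] := H a.
Qed.

Definition itin n (s : 'S_n) (j : nat) (x : 'I_n) (i : nat) : bool :=
  j <= (s ^+ i)%g x.

Section Cut.

Variables (n : nat) (s : 'S_n) (j : nat).
Hypothesis cut_s : cut s j.

Local Notation it := (itin s j).

Lemma itin_iter x r i : it ((s ^+ r)%g x) i = it x (r + i).
Proof. by rewrite /itin -permM -expgD. Qed.

Lemma itinS x i : it (s x) i = it x i.+1.
Proof. by have -> : s x = (s ^+ 1)%g x by []; rewrite itin_iter. Qed.

Lemma eq_itin_iter x y r : it x =1 it y -> it ((s ^+ r)%g x) =1 it ((s ^+ r)%g y).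
Proof. by move=> xy i; rewrite !itin_iter xy. Qed.

Lemma cut_lt (u v : 'I_n) : (j <= u) = (j <= v) ->
  (s u < s v) = if j <= u then v < u else u < v.
Proof.
move=> uv; have [H1 H2] := cutP _ _ cut_s u v; have [H3 H4] := cutP _ _ cut_s v u.
have eq_s : u = v :> nat -> s u = s v :> nat by move/val_inj ->.
by case: (leqP j u) uv => ju; case: (leqP j v) => jv // _;
  case: (ltngtP u v) => uv; lia.
Qed.

(** Points with equal itineraries always lie on the same side of the cut, where one step keeps or
    reverses their order; [par] accumulates the reversals. *)
Lemma itin_lt x y i : it x =1 it y ->
  ((s ^+ i)%g x < (s ^+ i)%g y) = if par (it x) i then y < x else x < y.
Proof.
move=> xy; elim: i x y xy => [|i IHi] x y xy /=; first by rewrite !perm1.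
have yx : it y =1 it x by move=> r; rewrite xy.
rewrite !expgSr !permM cut_lt; last exact: (xy i).
rewrite -[j <= _]/(it x i) !IHi // (eq_par i yx).
by case: (it x i); case: (par _ i).
Qed.

(** Points on different sides are separated by the first letter; on a common side, [s] and the
    recursion of [key] reverse the order under the same condition. *)
Lemma key_itin M (x y : 'I_n) : x <= y -> key M (it x) <= key M (it y).
Proof.
elim: M x y => //= M IHM x y; rewrite leq_eqVlt => /predU1P[/val_inj-> //|lt].
have E z : key M (fun i => it z i.+1) = key M (it (s z)).
  by apply: eq_key => i; rewrite itinS.
rewrite !E /itin !perm1 expnS.
have := key_bound M (it (s x)); have := key_bound M (it (s y)).
have := @cut_lt x y; have := @cut_lt y x.
have := IHM (s x) (s y); have := IHM (s y) (s x).
rewrite /itin.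
move: (key M _) (key M _) => kx ky.
case: (leqP j x) => jx; case: (leqP j y) => jy; lia.
Qed.

(** The power [s ^+ q] preserves the order among points with the itinerary of [x]. Hence the orbit
    of [x] under it is monotone, and finite order makes it constant. *)
Lemma itin_even_fix q x : it ((s ^+ q)%g x) =1 it x -> par (it x) q = false ->
  (s ^+ q)%g x = x.
Proof.
move=> per ev; pose h := (s ^+ q)%g.
have per_r r : it ((h ^+ r)%g x) =1 it x.
  elim: r => [|r IHr] i; first by rewrite perm1.
  by rewrite expgSr permM itin_iter IHr -itin_iter per.
have h_lt u v : it u =1 it x -> it v =1 it x -> (h u < h v) = (u < v).
  move=> ux vx; rewrite /h itin_lt; last by move=> i; rewrite ux vx.
  by rewrite (eq_par _ ux) ev.
have hS r : (h ^+ r.+1)%g x = h ((h ^+ r)%g x) by rewrite expgSr permM.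
have step r : ((h ^+ r.+1)%g x < (h ^+ r.+2)%g x) = ((h ^+ r)%g x < (h ^+ r.+1)%g x).
  by rewrite -[RHS]h_lt // -!hS.
have step' r : ((h ^+ r.+2)%g x < (h ^+ r.+1)%g x) = ((h ^+ r.+1)%g x < (h ^+ r)%g x).
  by rewrite -[RHS]h_lt // -!hS.
have all_steps r : (((h ^+ r)%g x < (h ^+ r.+1)%g x) = (x < h x)) *
                   (((h ^+ r.+1)%g x < (h ^+ r)%g x) = (h x < x)).
  elim: r => [|r [IH1 IH2]]; first by rewrite expg0 expg1 perm1.
  by rewrite step step' IH1 IH2.
have hN : (h ^+ #[h]%g.-1.+1)%g x = x by rewrite prednK ?order_gt0 // expg_order perm1.
apply/val_inj; case: (ltngtP (h x) x) => // lt.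
  have dec r : (h ^+ r.+1)%g x < x.
    elim: r => [|r IHr]; first by rewrite expg1.
    by apply: ltn_trans IHr; rewrite all_steps.
  by have := dec #[h]%g.-1; rewrite hN ltnn.
have inc r : x < (h ^+ r.+1)%g x.
  elim: r => [|r IHr]; first by rewrite expg1.
  by apply: ltn_trans IHr _; rewrite all_steps.
by have := inc #[h]%g.-1; rewrite hN ltnn.
Qed.

End Cut.

(** The peak can be put on either side: the cut [p] leaves it on the right, [p.+1] on the left. *)
Lemma unimodal_two_cuts n (s : 'S_n) : 0 < n -> unimodal s ->
  exists2 p, p < n & forall j, j <= n -> cut s j = (j == p) || (j == p.+1).
Proof.
move=> n_gt0 /existsP[m /forallP Hm].
have Um (a b : 'I_n) : (a < b <= m -> s a < s b) /\ (m <= a < b -> s b < s a).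
  by have /forallP/(_ b)/andP[/implyP H1 /implyP H2] := Hm a.
exists m => // j le_jn; apply/cutP/orP => [H|[]/eqP -> a b]; last 2 first.
- by have [H1 H2] := Um a b; split => // /andP[ab bm]; apply: H1; rewrite ab ltnW.
- by have [H1 H2] := Um a b; split => // /andP[ab bm]; apply: H2; rewrite bm ltnW.
case: (ltngtP j m) => [lt_jm||]; [|rewrite leq_eqVlt => /orP[/eqP <-|lt_mj]|by left].
- have lt_m1 : m.-1 < n by have := ltn_ord m; lia.
  have /= [_ H2] := H (Ordinal lt_m1) m; have /= [H1 _] := Um (Ordinal lt_m1) m.
  by have := H1 ltac:(lia); have := H2 ltac:(lia); lia.
- by right.
have lt_m1 : m.+1 < n by apply: leq_trans le_jn.
have /= [H1 _] := H m (Ordinal lt_m1); have /= [_ H2] := Um m (Ordinal lt_m1).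
by have := H1 ltac:(lia); have := H2 ltac:(lia); lia.
Qed.

(** The peak is whichever of the two points next to the cut has the larger image; at an extreme cut
    only one such point exists. *)
Lemma cut_unimodal n (s : 'S_n) j : 0 < n -> j <= n -> cut s j -> unimodal s.
Proof.
move=> n_gt0 le_jn cut_s.
have wit (m : 'I_n) : (forall a b : 'I_n, (a < b <= m -> s a < s b) /\
    (m <= a < b -> s b < s a)) -> unimodal s.
  move=> H; apply/existsP; exists m; apply/forallP => a; apply/forallP => b.
  by have [H1 H2] := H a b; apply/andP; split; apply/implyP.
have C := cutP _ _ cut_s.
have [j0|j_gt0] := posnP j.
  apply: (wit (Ordinal n_gt0)) => a b /=; split; first by lia.
  by move=> ab; apply: (C a b).2; lia.
have lt_j1 : j.-1 < n by lia.
pose p := Ordinal lt_j1.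
case: (leqP n j) => [le_nj|lt_jn].
  apply: (wit p) => a b /=; have := ltn_ord b; split => ab; last by lia.
  by apply: (C a b).1; lia.
pose q := Ordinal lt_jn.
have pq : s p != s q :> nat by apply/eqP => /val_inj/perm_inj/(congr1 val) /=; lia.
case: (ltngtP (s p) (s q)) pq => // lt _.
  apply: (wit q) => a b /=; split => [/andP[ab bq]|ab]; last first.
    by apply: (C a b).2; lia.
  case: (ltngtP b j) bq => // [bj|bj] _; first by apply: (C a b).1; lia.
  have -> : b = q by apply: val_inj.
  case: (ltngtP a j.-1) => [ap||ap]; [|lia|].
    by apply: ltn_trans lt; apply: (C a p).1 => /=; lia.
  by have -> : a = p by apply: val_inj.
apply: (wit p) => a b /=; split => [ab|/andP[pa ab]].
  by apply: (C a b).1; lia.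
case: (ltngtP a j.-1) pa => // [ap|ap] _; first by apply: (C a b).2; lia.
have -> : a = p by apply: val_inj.
case: (ltngtP b j) => [|bj|bj]; [lia| |].
  by apply: ltn_trans lt; apply: (C q b).2 => /=; lia.
by have -> : b = q by apply: val_inj.
Qed.

(** * Counting cuts *)

Lemma sorted_enum_set n (S : {pred 'I_n}) : sorted (relpre val ltn) (enum S).
Proof.
rewrite /enum_mem -enumT; apply: sorted_filter => [x y z|]; first exact: ltn_trans.
by rewrite -sorted_map val_enum_ord iota_ltn_sorted.
Qed.

(** Both maps list the same set in the order [e], and a strictly sorted list is determined by its
    members. *)
Lemma monotone_image_inj (T : finType) (e : rel T) m (f g : 'I_m -> T) (D : {set 'I_m}) :
  transitive e -> irreflexive e ->
  {in D &, forall x y : 'I_m, x < y -> e (f x) (f y)} ->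
  {in D &, forall x y : 'I_m, x < y -> e (g x) (g y)} ->
  f @: D = g @: D -> {in D, f =1 g}.
Proof.
move=> e_tr e_irr f_mon g_mon fg x xD.
have srt (h : 'I_m -> T) : {in D &, forall x y : 'I_m, x < y -> e (h x) (h y)} ->
    sorted e [seq h x | x <- enum D].
  move=> h_mon; apply: (@homo_sorted_in _ _ (mem D) h (relpre val ltn)) => //.
    by apply/allP => y; rewrite mem_enum.
  exact: sorted_enum_set.
have /eq_in_map : [seq f x | x <- enum D] = [seq g x | x <- enum D].
  apply: (irr_sorted_eq e_tr e_irr (srt f f_mon) (srt g g_mon)) => y.
  have memE (h : 'I_m -> T) : (y \in [seq h x | x <- enum D]) = (y \in h @: D).
    by apply/mapP/imsetP => -[z zD ->]; exists z; rewrite ?mem_enum in zD *.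
  by rewrite !memE fg.
by apply; rewrite mem_enum.
Qed.

Definition cuts (n : nat) : {set 'S_n * 'I_n.+1} := 
  [set X : 'S_n * 'I_n.+1 | cut X.1 X.2].

Definition left_image n (X : 'S_n * 'I_n.+1) : {set 'I_n} :=
  X.1 @: [set x : 'I_n | x < X.2].

Lemma card_ltn_ord n j : j <= n -> #|[set x : 'I_n | x < j]| = j.
Proof.
move=> jn; rewrite -sum1dep_card -(big_ord_widen n (fun=> 1) jn).
by rewrite sum_nat_const card_ord muln1.
Qed.

Lemma card_geq_ord n j : j <= n -> \sum_(x < n) (j <= x) = n - j.
Proof.
elim: n => [|n IHn]; first by rewrite big_ord0 sub0n.
rewrite big_ord_recr /= leq_eqVlt => /predU1P[->|].
  rewrite big1 ?ltnn ?subnn // => i _; first by apply/eqP; rewrite eqb0 -ltnNge ltnS ltnW.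
by rewrite ltnS => jn; rewrite IHn // jn addn1 subSn.
Qed.

(** The size of the image recovers the cut; monotonicity then recovers the permutation on the left
    from the image and on the right from its complement. *)
Lemma left_image_inj n : {in cuts n &, injective (@left_image n)}.
Proof.
move=> [s j] [t i]; rewrite !inE /= => s_cut t_cut; rewrite /left_image /= => st.
have ij : j = i.
  have := congr1 (fun A : {set _} => #|A|) st.
  rewrite /= !card_imset; [|exact: perm_inj..].
  by rewrite !card_ltn_ord -1?ltnS // => /val_inj.
rewrite -{i}ij in t_cut st *; congr pair; apply/permP => x.
have lt_tr : transitive (relpre val ltn : rel 'I_n) by move=> ? ? ?; apply: ltn_trans.
have gt_tr : transitive (relpre val gtn : rel 'I_n) by move=> ? ? ? /=; lia.
have lt_irr : irreflexive (relpre val ltn : rel 'I_n) by move=> ?; apply: ltnn.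
have gt_irr : irreflexive (relpre val gtn : rel 'I_n) by move=> ?; apply: ltnn.
have [xj|jx] := ltnP x j.
  apply: (monotone_image_inj lt_tr lt_irr _ _ st); rewrite ?inE // => a b;
    rewrite !inE /= => _ bj ab.
    by apply: ((cutP _ _ s_cut) a b).1; lia.
  by apply: ((cutP _ _ t_cut) a b).1; lia.
have C (u : 'S_n) : u @: [set x : 'I_n | j <= x] = ~: (u @: [set x : 'I_n | x < j]).
  rewrite -!preim_permV -preimsetC; congr (_ @^-1: (_ : {set _})).
  by apply/setP => y; rewrite !inE leqNgt.
apply: (monotone_image_inj gt_tr gt_irr _ _ (D := [set x : 'I_n | j <= x]));
  rewrite ?inE ?C ?st // => a b; rewrite !inE /= => aj _ ab.
  by apply: ((cutP _ _ s_cut) a b).2; lia.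
by apply: ((cutP _ _ t_cut) a b).2; lia.
Qed.

Lemma left_image_surj n (S : {set 'I_n}) :
  exists2 X, X \in cuts n & left_image X = S.
Proof.
(* The one-line notation of the permutation: [S] ascending, then its complement descending. *)
pose l := enum S ++ rev (enum (~: S)).
have sz_l : size l = n.
  by rewrite size_cat size_rev -!cardE cardsC card_ord.
have uniq_l : uniq l.
  rewrite cat_uniq rev_uniq !enum_uniq /= andbT.
  by apply/hasPn => y; rewrite mem_rev !mem_enum inE.
have f_inj : injective (fun x : 'I_n => nth x l x).
  move=> x y /eqP; rewrite (set_nth_default x) ?sz_l //.
  by rewrite nth_uniq ?sz_l // => /eqP/val_inj.
have [c cE] : exists c, c = size (enum S) by eexists.
have le_Sn : c < n.+1 by rewrite ltnS -sz_l size_cat -cE leq_addr.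
have sz_C : size (enum (~: S)) = n - c.
  by rewrite cE -[RHS](congr1 (subn^~ _) sz_l) size_cat size_rev addKn.
have sE x0 x : x < c -> nth x0 l x = nth x0 (enum S) x.
  by move=> xS; rewrite nth_cat -cE xS.
have sE' x0 x : c <= x -> x < n -> nth x0 l x = nth x0 (enum (~: S)) (n - x.+1).
  move=> Sx xn; rewrite nth_cat -cE ltnNge Sx /= nth_rev sz_C; last by lia.
  by congr nth; lia.
have e_tr : transitive (relpre val ltn : rel 'I_n) by move=> ? ? ?; apply: ltn_trans.
exists (perm f_inj, Ordinal le_Sn); last first.
  apply/eqP; rewrite eqEcard card_imset; last exact: perm_inj.
  rewrite card_ltn_ord //= [#|S|]cardE -cE leqnn andbT.
  apply/subsetP => y /imsetP[x]; rewrite inE /= => xS ->.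
  by rewrite permE sE // -mem_enum mem_nth // -cE.
rewrite inE /=; apply/cutP => a b; rewrite !permE; split => ab.
  rewrite [nth b _ _](set_nth_default a) ?sz_l // !sE; [|lia..].
  by apply: (sorted_ltn_nth e_tr a (sorted_enum_set (mem S))); rewrite ?inE -?cE; lia.
have := ltn_ord a; have := ltn_ord b => bn an.
rewrite [nth b _ _](set_nth_default a) ?sz_l // !sE'; [|lia..].
by apply: (sorted_ltn_nth e_tr a (sorted_enum_set (mem (~: S)))); rewrite ?inE ?sz_C; lia.
Qed.

Lemma card_cuts n : #|cuts n| = 2 ^ n.
Proof.
rewrite -(card_in_imset (@left_image_inj n)) -[n in RHS]card_ord -cardsT -card_powerset.
congr #|pred_of_set _|; apply/setP => S; rewrite !inE subsetT.
by apply/imsetP; have [X cX <-] := left_image_surj S; exists X.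
Qed.

(** * Cycles of a given shape *)

Section SingleCycle.

Variables (k' : nat).
Local Notation k := k'.+1.
Variable d : 'S_k.
Hypothesis d_cyc : porbits d == [set [set: 'I_k]].

Lemma porbit_single x : porbit d x = [set: 'I_k].
Proof.
have : porbit d x \in porbits d by apply: imset_f.
by rewrite (eqP d_cyc) inE => /eqP.
Qed.

Lemma expg_single : (d ^+ k)%g = 1%g.
Proof.
apply/permP => x; rewrite permX perm1.
by have := iter_porbit d x; rewrite porbit_single cardsT card_ord.
Qed.

Lemma expg_inj_single x i r : i < k -> r < k -> (d ^+ i)%g x = (d ^+ r)%g x -> i = r.
Proof.
have := uniq_traject_porbit d x; rewrite porbit_single cardsT card_ord => uniq_x ik rk.
rewrite !permX -(nth_traject d ik x) -(nth_traject d rk x) => /eqP.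
by rewrite nth_uniq ?size_traject // => /eqP.
Qed.

Lemma expg_surj_single x y : exists i : 'I_k, (d ^+ i)%g x = y.
Proof.
have : y \in porbit d x by rewrite porbit_single inE.
rewrite porbit_traject porbit_single cardsT card_ord => /trajectP[i ik ->].
by exists (Ordinal ik); rewrite permX.
Qed.

Lemma expg_mod_single x i r : (d ^+ i)%g x = (d ^+ r)%g x -> i = r %[mod k].
Proof.
rewrite -(expg_mod i expg_single) -(expg_mod r expg_single).
by move=> /expg_inj_single -> //; apply: ltn_pmod.
Qed.

(** In [k] steps the cycle visits each point once, and [k - j] points lie on the right. *)
Lemma par_itin_single j x : j <= k -> par (itin d j x) k = odd (k - j).
Proof.
move=> jk; rewrite par_sum -(card_geq_ord jk); congr odd.
have inj : injective (fun i : 'I_k => (d ^+ i)%g x).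
  by move=> i r /expg_inj_single E; apply: val_inj; apply: E.
by rewrite [RHS](reindex_inj inj).
Qed.

End SingleCycle.

Lemma tagged_perm_eq m (c : 'S_m) k (d : 'S_k) (e : m = k) :
  (forall i, d (cast_ord e i) = cast_ord e (c i)) ->
  Tagged (fun k => 'S_k) c = Tagged (fun k => 'S_k) d.
Proof.
case: _ / e in d * => H; congr Tagged; apply/permP => i.
by have := H i; rewrite !cast_ord_id.
Qed.

(** For a given cycle, [Omega] serves as [g]. Conversely the range of [g] is one orbit because [d]
    is a single cycle, and its increasing enumeration is unique. *)
Lemma has_cycle_of_shapeP n (s : 'S_n) k' (d : 'S_k'.+1) :
  porbits d == [set [set: 'I_k'.+1]] ->
  reflect (exists2 g : 'I_k'.+1 -> 'I_n, {homo g : i j / i < j} &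
             forall i, s (g i) = g (d i))
          (has_cycle_of_shape s d).
Proof.
move=> d_cyc; apply: (iffP existsP) => [[J /andP[J_orb /eqP E]]|[g g_inc gE]].
  (* A predicate on the total space allows rewriting with the tagged equality. *)
  pose P (u : {k : nat & 'S_k}) := exists2 g : 'I_(tag u) -> 'I_n,
    {homo g : i j / i < j} & forall i, s (g i) = g (tagged u i).
  change (P (Tagged (fun k => 'S_k) d)); rewrite -E.
  exists (@Omega n J); last by move=> i; rewrite /= Omega_cycle_shape.
  by move=> i j; rewrite (proj1 (OmegaP J)).
have g_inj : injective g.
  move=> i j E; apply/val_inj; case: (ltngtP i j) => // /g_inc; by rewrite E ltnn.
have gX r i : (s ^+ r)%g (g i) = g ((d ^+ r)%g i).
  by elim: r => [|r IHr]; rewrite ?perm1 // !expgSr !permM IHr gE.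
pose J := g @: [set: 'I_k'.+1].
have JE : J = porbit s (g ord0).
  apply/setP => y; apply/imsetP/porbitP => [[i _ ->]|[r ->]]; last first.
    by exists ((d ^+ r)%g ord0); rewrite ?inE.
  by have [r <-] := expg_surj_single d_cyc ord0 i; exists r; rewrite gX.
have J_orb : J \in porbits s by rewrite JE; apply: imset_f.
exists J; rewrite J_orb /=; apply/eqP.
have cJ : #|J| = k'.+1 by rewrite card_imset // cardsT card_ord.
apply: (@tagged_perm_eq _ _ _ _ cJ) => i; apply: g_inj; rewrite -gE.
have gO : (g \o cast_ord cJ) =1 @Omega n J.
  have lt_tr : transitive (relpre val ltn : rel 'I_n) by move=> ? ? ?; apply: ltn_trans.
  have lt_irr : irreflexive (relpre val ltn : rel 'I_n) by move=> ?; apply: ltnn.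
  move=> x; apply: (monotone_image_inj (D := setT) lt_tr lt_irr) => //.
  - by move=> a b _ _ ab; apply: g_inc.
  - by move=> a b _ _ ab; rewrite /= (proj1 (OmegaP J)).
  apply/setP => y; transitivity (y \in J).
    apply/imsetP/imsetP => -[a _ ->]; first by exists (cast_ord cJ a).
    exists (cast_ord (esym cJ) a); first by rewrite inE.
    by congr g; apply: val_inj.
  apply/idP/imsetP => [/(proj2 (OmegaP J))[a <-]|[a _ ->]]; first by exists a.
  by apply/(proj2 (OmegaP J)); exists a.
by rewrite -[g _]/((g \o cast_ord cJ) _) -[RHS]/((g \o cast_ord cJ) _) !gO
   Omega_cycle_shape.
Qed.

Section Embedding.

Variables (k' n : nat).
Local Notation k := k'.+1.
Variables (d : 'S_k) (i : nat) (s : 'S_n) (j : nat).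
Hypothesis (d_cyc : porbits d == [set [set: 'I_k]]).
Hypothesis (d_cut : cut d i) (s_cut : cut s j).
Local Notation o := (ord0 : 'I_k).

(* Points with different itineraries are ordered by these; the order of points *)
(* with equal itineraries is transported from the base point along the cycle. *)
Lemma shape_embedding (x : 'I_n) :
    itin s j x =1 itin d i o -> (s ^+ k)%g x = x ->
    (forall q, itin d i ((d ^+ q)%g o) =1 itin d i o -> (d ^+ q)%g o != o ->
       x < (s ^+ q)%g x) ->
  has_cycle_of_shape s d.
Proof.
move=> xo sk H; apply/has_cycle_of_shapeP => //.
have [idx idxE] := fin_all_exists (expg_surj_single d_cyc o).
have sX a b : (d ^+ a)%g o = (d ^+ b)%g o -> (s ^+ a)%g x = (s ^+ b)%g x.
  move=> /(expg_mod_single d_cyc) ab.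
  have sm c : (s ^+ c)%g x = (s ^+ (c %% k))%g x.
    rewrite {1}(divn_eq c k) addnC expgD permM mulnC expgM.
    set y := (s ^+ _)%g x.
    have yk : (s ^+ k)%g y = y by rewrite /y -permM -expgD addnC expgD permM sk.
    elim: (c %/ k) => [|c' IH]; first by rewrite perm1.
    by rewrite expgSr permM IH.
  by rewrite sm ab -sm.
pose g u := (s ^+ idx u)%g x.
have gE a : g ((d ^+ a)%g o) = (s ^+ a)%g x by apply: sX; rewrite idxE.
exists g; last first.
  move=> u; have -> : d u = (d ^+ (idx u).+1)%g o by rewrite expgSr permM idxE.
  by rewrite gE /g expgSr permM.
have g_it u : itin s j (g u) =1 itin d i u.
  by move=> r; rewrite -[u in RHS]idxE !itin_iter.
have per u r : itin d i u (r %% k) = itin d i u r.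
  by rewrite /itin expg_mod // expg_single.
move=> u v uv; have [E|neq] := eqVneq (trunc k' (itin d i u)) (trunc k' (itin d i v)).
  have {}E : itin d i u =1 itin d i v.
    by move=> r; rewrite -(letter_trunc (per u)) E letter_trunc.
  (* Rotating by [d ^+ r] takes [u] to the base point [o] and [v] to a point [w] with the itinerary
     of [o]. *)
  pose r := k - idx u; pose w := (d ^+ r)%g v.
  have ko : (d ^+ r)%g u = o.
    by rewrite -[u]idxE -permM -expgD subnKC ?expg_single ?perm1 // ltnW.
  have v_w : v = (d ^+ idx u)%g w.
    by rewrite /w -permM -expgD subnK ?expg_single ?perm1 // ltnW.
  have [q qE] := expg_surj_single d_cyc o w.
  have it_w : itin d i w =1 itin d i o.
    by move=> c; rewrite /w -ko; apply/esym/eq_itin_iter.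
  have w_o : w != o.
    by apply: contraTneq uv => wo; rewrite v_w wo idxE ltnn.
  have lt_x : x < (s ^+ q)%g x by apply: H; rewrite qE.
  have it_q : itin s j x =1 itin s j ((s ^+ q)%g x).
    by move=> c; rewrite itin_iter !xo -itin_iter qE it_w.
  have -> : g u = (s ^+ idx u)%g x by [].
  have -> : g v = (s ^+ idx u)%g ((s ^+ q)%g x).
    have -> : v = (d ^+ (q + idx u))%g o by rewrite expgD permM qE.
    by rewrite gE expgD permM.
  (* As [o] is the least point, [u < v] forces [idx u] steps to preserve the order, and they then do
     so for [s] as well. *)
  rewrite (itin_lt s_cut _ it_q) (eq_par _ xo).
  have := itin_lt d_cut (idx u) (fun c => esym (it_w c)).
  by rewrite idxE -v_w uv; case: (par _ _) => //; rewrite ltn0.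
(* Otherwise both weak comparisons of keys would hold, making the itineraries equal. *)
rewrite ltnNge; apply: contra neq => vu.
have kk := key_itin s_cut k vu; have kk' := key_itin d_cut k (ltnW uv).
rewrite !(eq_key _ (g_it _)) in kk.
have /key_inj E : key k (itin d i u) = key k (itin d i v) by lia.
by apply/eqP/ffunP => r; rewrite !ffunE E.
Qed.

End Embedding.

(** * Multiplicities of itineraries *)

Section Blocks.

Variable N' : nat.
Local Notation N := N'.+1.

Definition itin_word n (s : 'S_n) (j : nat) (x : 'I_n) : word N' :=
  trunc N' (itin s j x).

Definition block n (s : 'S_n) (j : nat) (t : word N') : {set 'I_n} :=
  [set x | itin_word s j x == t].

Definition mult n (s : 'S_n) (j : nat) (t : word N') : nat := #|block s j t|.

Lemma letter_itin_word n (s : 'S_n) j x :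
  (s ^+ N)%g = 1%g -> letter (itin_word s j x) =1 itin s j x.
Proof. by move=> sN; apply: letter_trunc => i; rewrite /itin expg_mod. Qed.

Lemma itin_word_step n (s : 'S_n) j x :
  (s ^+ N)%g = 1%g -> itin_word s j (s x) = shift (itin_word s j x).
Proof.
move=> sN; apply: letter_inj => i.
by rewrite letter_shift !letter_itin_word // itinS.
Qed.

(** The permutation [s] maps the block of [t] bijectively onto the block of [shift t]. *)
Lemma mult_shift n (s : 'S_n) j t :
  (s ^+ N)%g = 1%g -> mult s j (shift t) = mult s j t.
Proof.
move=> sN; rewrite /mult -[RHS](card_imset _ (@perm_inj _ s)); congr #|pred_of_set _|.
apply/setP => x; rewrite inE; apply/eqP/imsetP => [xt|[y]].
  exists ((s^-1)%g x); last by rewrite permKV.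
  by rewrite inE -(can_eq (@shiftK N')) -itin_word_step // permKV xt.
by rewrite inE => /eqP <- ->; rewrite itin_word_step.
Qed.

Lemma mult_iter_shift n (s : 'S_n) j t r :
  (s ^+ N)%g = 1%g -> mult s j (iter r (@shift N') t) = mult s j t.
Proof. by move=> sN; elim: r => //= r <-; apply: mult_shift. Qed.

Lemma itin_word_iter n (s : 'S_n) j x r :
  (s ^+ N)%g = 1%g -> itin_word s j ((s ^+ r)%g x) = iter r (@shift N') (itin_word s j x).
Proof.
move=> sN; elim: r => [|r IHr]; first by rewrite perm1.
by rewrite expgSr permM itin_word_step // IHr.
Qed.

Lemma sum_mult n (s : 'S_n) j : \sum_t mult s j t = n.
Proof.
rewrite -[RHS]card_ord -sum1_card (partition_big (itin_word s j) predT) //=.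
by apply: eq_bigr => t _; rewrite sum1dep_card.
Qed.

(* On the block of a periodic itinerary of odd parity, [s ^+ k] is a decreasing *)
(* involution.                                                                  *)
Lemma odd_mult n (s : 'S_n) j t k :
    cut s j -> (s ^+ N)%g = 1%g ->
    (forall i, letter t (k + i) = letter t i) -> par (letter t) k ->
  odd (mult s j t) = [exists x in block s j t, (s ^+ k)%g x == x].
Proof.
move=> s_cut sN t_per t_odd; set B := block s j t; pose h := (s ^+ k)%g.
have itB x : x \in B -> itin s j x =1 letter t.
  by rewrite inE => /eqP <- i; rewrite letter_itin_word.
have hB x : x \in B -> h x \in B.
  move=> xB; rewrite inE; apply/eqP/letter_inj => i.
  by rewrite letter_itin_word // itin_iter itB.
(* Two periods together have even parity, so [itin_even_fix] applies. *)
have hK x : x \in B -> h (h x) = x.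
  move=> xB; rewrite -permM -expgD.
  apply: (itin_even_fix s_cut).
    by move=> i; rewrite expgD permM (itB _ (hB _ (hB _ xB))) itB.
  rewrite (eq_par _ (itB _ xB)) parD t_odd.
  by rewrite (eq_par _ t_per) t_odd.
have h_lt x y : x \in B -> y \in B -> (h x < h y) = (y < x).
  move=> xB yB; rewrite (itin_lt s_cut); last by move=> i; rewrite !itB.
  by rewrite (eq_par _ (itB _ xB)) t_odd.
pose L := [set x : 'I_n | x < h x]; pose G := [set x : 'I_n | h x < x].
(* [h] exchanges the points it moves up with those it moves down, so only its fixed points matter
   modulo 2. *)
have LG : #|B :&: L| = #|(B :\: L) :&: G|.
  rewrite -(card_imset _ (@perm_inj _ h)); congr #|pred_of_set _|.
  apply/setP => y; rewrite !inE; apply/imsetP/idP => [[x]|/andP[/andP[yL yB] yG]].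
    rewrite !inE => /andP[xB xh] ->; rewrite hK ?inE // xh andbT -leqNgt ltnW //.
    by have := hB x; rewrite !inE; apply.
  have {}yB : y \in B by rewrite inE.
  by exists (h y); rewrite ?hK // !inE hK // yG andbT; have := hB y yB; rewrite inE.
pose F := (B :\: L) :\: G.
have cB : #|B| = (#|B :&: L|).*2 + #|F|.
  by rewrite -(cardsID L B) -(cardsID G (B :\: L)) -LG addnA addnn.
have FE x : (x \in F) = (x \in B) && (h x == x).
  rewrite in_setD in_setD !inE -!leqNgt -val_eqE /= eqn_leq.
  by case: (_ == t); rewrite ?andbF ?andbT //= andbC.
rewrite /mult -/B cB oddD odd_double /=; apply/idP/existsP => [oddF|[x xF]].
  have /card_gt0P[x xF] : 0 < #|F| by case: #|F| oddF.
  by exists x; rewrite FE in xF.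
(* A decreasing map has at most one fixed point. *)
have -> : F = [set x]; last by rewrite cards1.
move: xF; rewrite -FE => xF; apply/setP => y; rewrite inE.
apply/idP/eqP => [|-> //]; rewrite FE => /andP[yB /eqP hy].
move: xF; rewrite FE => /andP[xB /eqP hx].
have := h_lt x y xB yB; have := h_lt y x yB xB; rewrite hx hy => l1 l2.
by apply/val_inj; case: (ltngtP y x) => // lt; move: l1 l2; rewrite lt; lia.
Qed.

(** * Detecting a cycle of given shape from multiplicities *)

Section Shape.

Variables (k' : nat).
Local Notation k := k'.+1.
Variable d : 'S_k.
Hypothesis d_cyc : porbits d == [set [set: 'I_k]].
Hypothesis dN : (d ^+ N)%g = 1%g.
Local Notation o := (ord0 : 'I_k).

Lemma single_period j i : letter (itin_word d j o) (k + i) = letter (itin_word d j o) i.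
Proof. by rewrite !letter_itin_word // -itin_iter expg_single // perm1. Qed.

Lemma par_itin_word j x : j <= k -> par (letter (itin_word d j x)) k = odd (k - j).
Proof.
by move=> jk; rewrite (eq_par _ (letter_itin_word _ _ dN)) par_itin_single.
Qed.

(** With an odd number of points on the right, [d ^+ k] would reverse the order of two points
    sharing an itinerary, yet it is the identity. *)
Lemma itin_word_inj j : j <= k -> cut d j -> odd (k - j) -> injective (itin_word d j).
Proof.
move=> jk d_cut odd_j x y E.
have xy : itin d j x =1 itin d j y.
  by move=> i; rewrite -!letter_itin_word // E.
have := itin_lt d_cut k xy; have := itin_lt d_cut k (fun i => esym (xy i)).
rewrite !expg_single // !perm1 !par_itin_single // odd_j => l1 l2.
by apply/val_inj; case: (ltngtP x y) => // lt; move: l1 l2; rewrite lt; lia.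
Qed.

Lemma mult_base_odd j : j <= k -> cut d j -> odd (k - j) ->
  mult d j (itin_word d j o) = 1.
Proof.
move=> jk d_cut odd_j; rewrite /mult (_ : block _ _ _ = [set o]) ?cards1 //.
by apply/setP => x; rewrite !inE (inj_eq (itin_word_inj jk d_cut odd_j)).
Qed.

(** The parity of the first [k] letters depends only on the cut, so cuts of opposite parity share no
    itinerary. *)
Lemma mult_base_parity i j : i <= k -> j <= k -> odd (k - i) != odd (k - j) ->
  mult d j (itin_word d i o) = 0.
Proof.
move=> ik jk; apply: contraNeq; rewrite -lt0n => /card_gt0P[x].
by rewrite inE => /eqP E; rewrite -(par_itin_word o ik) -(par_itin_word x jk) E.
Qed.

Lemma mult_neq0_orbit j t : mult d j t != 0 ->
  exists r, t = iter r (@shift N') (itin_word d j o).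
Proof.
rewrite -lt0n => /card_gt0P[x]; rewrite inE => /eqP <-.
by have [r <-] := expg_surj_single d_cyc o x; exists r; rewrite itin_word_iter.
Qed.

Lemma induced_cut n (s : 'S_n) j (g : 'I_k -> 'I_n) :
    cut s j -> {homo g : x y / x < y} -> (forall x, s (g x) = g (d x)) ->
  exists j', [/\ j' <= k, cut d j' & forall x : 'I_k, (j' <= x) = (j <= g x)].
Proof.
move=> s_cut g_inc gE.
(* The cut is pulled back along [g]: [j'] is the least index from which on all points are sent to
   the right. *)
pose Q j' := [forall x : 'I_k, (j' <= x) ==> (j <= g x)].
have Qk : exists j', Q j'.
  by exists k; apply/forallP => x; rewrite leqNgt ltn_ord.
have g_le (x y : 'I_k) : x <= y -> g x <= g y.
  by rewrite leq_eqVlt => /predU1P[/val_inj ->|/g_inc/ltnW].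
have g_lt (x y : 'I_k) : g x < g y -> x < y.
  by move=> gxy; rewrite ltnNge; apply: contraTN gxy => /g_le; rewrite -leqNgt.
case: (ex_minnP Qk) => j' /forallP Qj' min_j'.
have j'E (x : 'I_k) : (j' <= x) = (j <= g x).
  apply/idP/idP => [|jg]; first by have /implyP := Qj' x.
  apply: min_j'; apply/forallP => y; apply/implyP => /g_le.
  exact: leq_trans.
exists j'; split=> //.
  by apply: min_j'; apply/forallP => x; rewrite leqNgt ltn_ord.
apply/cutP => a b; have [H1 H2] := cutP _ _ s_cut (g a) (g b).
split=> /andP[ab bj]; apply: g_lt; rewrite -!gE.
  by apply: H1; rewrite g_inc //= ltnNge -j'E -ltnNge.
by apply: H2; rewrite g_inc // andbT -j'E.
Qed.

(* The base point of a cycle of shape [d] is the least point of its block when *)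
(* the itinerary is even, and the middle point when it is odd.                 *)
Lemma has_shape_mult jE jO n (s : 'S_n) j :
    jE <= k -> jO <= k -> cut d jE -> cut d jO -> ~~ odd (k - jE) -> odd (k - jO) ->
    (forall j, j <= k -> cut d j -> j = jE \/ j = jO) ->
    cut s j -> (s ^+ N)%g = 1%g ->
  has_cycle_of_shape s d =
    (mult d jE (itin_word d jE o) <= mult s j (itin_word d jE o)) ||
    odd (mult s j (itin_word d jO o)).
Proof.
move=> jE_k jO_k cut_E cut_O par_E par_O cut_EO s_cut sN.
set aE := itin_word d jE o; set aO := itin_word d jO o.
have par_aE : par (letter aE) k = false by rewrite par_itin_word //; apply: negbTE.
have par_aO : par (letter aO) k by rewrite par_itin_word.
apply/has_cycle_of_shapeP/orP => // [[g g_inc gE]|].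
  have [j' [j'k j'_cut j'E]] := induced_cut s_cut g_inc gE.
  have gX r x : (s ^+ r)%g (g x) = g ((d ^+ r)%g x).
    by elim: r => [|r IHr]; rewrite ?perm1 // !expgSr !permM IHr gE.
  have g_it x : itin_word s j (g x) = itin_word d j' x.
    by apply: letter_inj => i; rewrite !letter_itin_word // /itin gX j'E.
  have g_inj : injective g.
    by move=> a b E; apply/val_inj; case: (ltngtP a b) => // /g_inc; rewrite E ltnn.
  (* An even induced cut embeds the block of [aE] for [d] into that for [s]; an odd one makes [g o]
     a fixed point of [s ^+ k] in the block of [aO]. *)
  case: (cut_EO _ j'k j'_cut) => jj; [left|right]; rewrite jj in g_it.
    rewrite /mult -(card_imset _ g_inj); apply: subset_leq_card.
    by apply/subsetP => _ /imsetP[x xB ->]; rewrite !inE g_it in xB *.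
  rewrite (odd_mult s_cut sN (single_period jO)) //.
  by apply/existsP; exists (g o); rewrite inE g_it eqxx gX expg_single ?perm1 /=.
case=> [le_m|odd_m]; apply/(has_cycle_of_shapeP s d_cyc).
  have [x1 x1B] : exists x1, x1 \in block s j aE.
    by apply/card_gt0P; apply: leq_trans le_m; apply/card_gt0P; exists o; rewrite inE.
  case: (arg_minnP (P := mem (block s j aE)) val x1B) => x xB x_min.
  have itB y : y \in block s j aE -> itin s j y =1 itin d jE o.
    by rewrite inE => /eqP E i; rewrite -!letter_itin_word // E.
  have stB y q : y \in block s j aE -> itin d jE ((d ^+ q)%g o) =1 itin d jE o ->
      (s ^+ q)%g y \in block s j aE.
    move=> yB qE; rewrite inE; apply/eqP/letter_inj => i.
    by rewrite !letter_itin_word // itin_iter (itB _ yB) -itin_iter qE.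
  have dk : itin d jE ((d ^+ k)%g o) =1 itin d jE o by rewrite expg_single // perm1.
  apply: (shape_embedding d_cyc cut_E s_cut (itB _ xB)) => [|q qE q_o].
    apply: (itin_even_fix s_cut) => [i|]; first by rewrite (itB _ (stB _ _ xB dk)) itB.
    rewrite (eq_par _ (itB _ xB)) -par_aE.
    by apply: eq_par => i; rewrite letter_itin_word.
  (* Even parity over [q] steps would make [o] a fixed point of [d ^+ q]. *)
  have q_odd : par (itin d jE o) q.
    by apply: contraNT q_o => /negbTE ev; rewrite (itin_even_fix cut_E qE ev).
  (* Two points of [d] share the itinerary of [o], so the block of [s] has a second point [y] above
     [x]. As [s ^+ q] reverses the order there, it sends [x] above the image of [y], which is at
     least [x]. *)
  have : 1 < mult s j aE.
    apply: leq_trans le_m; apply/card_gt1P; exists o, ((d ^+ q)%g o).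
    split; rewrite 1?eq_sym // inE //.
    by apply/eqP/letter_inj => i; rewrite !letter_itin_word.
  case/card_gt1P => y1 [y2 [y1B y2B y12]].
  have [y yB y_x] : exists2 y, y \in block s j aE & y != x.
    by have [E|] := eqVneq y1 x; [exists y2; rewrite // -E eq_sym|exists y1].
  have xy : x < y by rewrite ltn_neqAle eq_sym y_x x_min.
  apply: leq_ltn_trans (x_min _ (stB _ _ yB qE)) _.
  rewrite (itin_lt s_cut); last by move=> i; rewrite !itB.
  by rewrite (eq_par _ (itB _ yB)) q_odd.
move: odd_m; rewrite (odd_mult s_cut sN (single_period jO)) // => /existsP[x].
rewrite inE => /andP[/eqP xO /eqP sx].
have it_x : itin s j x =1 itin d jO o.
  by move=> i; rewrite -!letter_itin_word // xO.
(* No other point of [d] shares the itinerary of [o] here, so the condition on [q] is vacuous. *)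
apply: (shape_embedding d_cyc cut_O s_cut it_x sx) => q qE /eqP[].
apply: (itin_word_inj jO_k cut_O par_O); apply: letter_inj => i.
by rewrite !letter_itin_word.
Qed.

End Shape.

End Blocks.

(** * Realization of multiplicity functions *)

Section Realization.

Variable N' : nat.
Local Notation N := N'.+1.
Local Notation word := (word N').

Lemma count_enum_ord n (P : pred 'I_n) : count P (enum 'I_n) = #|[set x | P x]|.
Proof.
by rewrite -sum1_count big_enum_cond sum1dep_card; apply: eq_card => x; rewrite !inE.
Qed.

(** A sorted list is determined by its multiplicities because [wle] is antisymmetric. *)
Lemma monotone_words_eq n (L L' : 'I_n -> word) :
  (forall x y : 'I_n, x < y -> wle (L x) (L y)) ->
  (forall x y : 'I_n, x < y -> wle (L' x) (L' y)) ->
  (forall t, #|[set x | L x == t]| = #|[set x | L' x == t]|) -> L =1 L'.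
Proof.
move=> L_mon L'_mon LL' x.
have srt (h : 'I_n -> word) : (forall x y : 'I_n, x < y -> wle (h x) (h y)) ->
    sorted (@wle N') [seq h x | x <- enum 'I_n].
  move=> h_mon; apply: (@homo_sorted _ _ h (relpre val ltn)); first exact: h_mon.
  exact: (sorted_enum_set (mem 'I_n)).
have /eq_in_map : [seq L x | x <- enum 'I_n] = [seq L' x | x <- enum 'I_n].
  apply: (sorted_eq (@wle_trans N') (@wle_anti N') (srt L L_mon) (srt L' L'_mon)).
  apply/allP => t _; apply/eqP; rewrite (count_map L) (count_map L') !count_enum_ord.
  exact: LL'.
by apply; rewrite mem_enum.
Qed.

Lemma itin_word_mono n (s : 'S_n) j (x y : 'I_n) :
  cut s j -> (s ^+ N)%g = 1%g -> x < y -> wle (itin_word N' s j x) (itin_word N' s j y).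
Proof.
move=> s_cut sN xy; rewrite /wle !(eq_key _ (letter_itin_word _ _ sN)).
exact: (key_itin s_cut _ (ltnW xy)).
Qed.

Lemma mult_inj n (X Y : 'S_n * 'I_n.+1) :
    X \in cuts n -> Y \in cuts n -> (forall s : 'S_n, (s ^+ N)%g = 1%g) ->
    (forall t : word, mult X.1 X.2 t = mult Y.1 Y.2 t) ->
  X = Y.
Proof.
move=> X_cut Y_cut sN XY; apply: left_image_inj => //.
have eq_it : itin_word N' X.1 X.2 =1 itin_word N' Y.1 Y.2.
  apply: monotone_words_eq => [x y|x y|t]; last exact: XY.
    by apply: itin_word_mono; rewrite // -?[cut _ _]/(_ \in _); rewrite inE in X_cut.
  by apply: itin_word_mono; rewrite // -?[cut _ _]/(_ \in _); rewrite inE in Y_cut.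
(* Since the power [N'] is the inverse permutation, the last letter records the side of the preimage
   of [y]. *)
have memE (Z : 'S_n * 'I_n.+1) y :
    (y \in left_image Z) = ~~ letter (itin_word N' Z.1 Z.2 y) N'.
  rewrite letter_itin_word // /itin -ltnNge.
  have -> : (Z.1 ^+ N')%g y = (Z.1^-1)%g y.
    by apply: (@perm_inj _ Z.1); rewrite permKV -permM -expgSr sN perm1.
  by rewrite /left_image -preim_permV !inE.
by apply/setP => y; rewrite !memE eq_it.
Qed.

(* The point carrying the x-th word in sorted order must come from the side     *)
(* given by the last letter of that word; this determines the pair [X].         *)
Lemma mult_surj n (f : word -> nat) :
    (forall t, f (shift t) = f t) -> \sum_t f t = n ->
  exists2 X, X \in cuts n & forall t, mult X.1 X.2 t = f t.
Proof.
move=> f_inv f_sum.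
pose lst := sort (@wle N') (flatten [seq nseq (f t) t | t <- enum {: word}]).
have cnt t : count_mem t lst = f t.
  rewrite count_sort count_flatten sumnE big_map big_map big_enum /= (bigD1 t) //=.
  rewrite count_nseq /= eqxx mul1n big1 ?addn0 // => u /negbTE ut.
  by rewrite count_nseq /= ut.
have sz : size lst = n.
  rewrite size_sort size_flatten /shape -map_comp sumnE big_map big_enum /=.
  by rewrite -[RHS]f_sum; apply: eq_bigr => t _; rewrite size_nseq.
pose t0 : word := [ffun=> false].
pose L (x : 'I_n) := nth t0 lst x.
have L_mon (x y : 'I_n) : x < y -> wle (L x) (L y).
  apply: (sorted_ltn_nth (@wle_trans N') t0 (sort_sorted (@wle_total N') _));
    by rewrite inE sz.
have L_le (x y : 'I_n) : x <= y -> wle (L x) (L y).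
  by rewrite leq_eqVlt => /predU1P[/val_inj ->|/L_mon //]; apply: leqnn.
have L_cnt t : #|[set x | L x == t]| = f t.
  rewrite -cnt -count_enum_ord -(count_map L (pred1 t)); congr count.
  apply: (@eq_from_nth _ t0); rewrite (size_map L) size_enum_ord ?sz // => i i_n.
  by rewrite (nth_map (Ordinal i_n)) ?size_enum_ord // /L nth_enum_ord.
have [[s j] s_cut left_S] := left_image_surj [set x | ~~ letter (L x) N'].
rewrite inE /= in s_cut.
have last_L x : letter (L (s x)) N' = (j <= x).
  have := congr1 (fun A : {set 'I_n} => s x \in A) left_S.
  rewrite /left_image /= mem_imset; last exact: perm_inj.
  by rewrite !inE [j <= x]leqNgt => ->; rewrite negbK.
have first_unshift (t : word) : letter (unshift t) 0 = letter t N'.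
  by rewrite /unshift letter_iter_shift addn0.
(* Both sides are sorted: unshifting prepends the side of [x], on which [s] is monotone in the
   matching direction. Shift invariance makes their multiplicities agree. *)
have L_shift x : L x = unshift (L (s x)).
  apply: (monotone_words_eq (L' := fun x => unshift (L (s x)))) => // [a b ab|t].
    have [ja|aj] := leqP j a.
      have jb : j <= b by apply: leq_trans ja (ltnW ab).
      rewrite wle_shift ?first_unshift !last_L ?ja ?jb // !unshiftK.
      by apply/L_le/ltnW/((cutP _ _ s_cut) a b).2; rewrite ja.
    have [jb|bj] := leqP j b.
      by apply: wle_first; rewrite first_unshift last_L // leqNgt aj.
    have [ja jb] : (j <= a) = false /\ (j <= b) = false by split; lia.
    rewrite wle_shift ?first_unshift !last_L ja ?jb // !unshiftK.
    by apply/L_le/ltnW/((cutP _ _ s_cut) a b).1; rewrite ab.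
  rewrite L_cnt -f_inv -L_cnt -(card_imset [set x0 | unshift _ == t] (@perm_inj _ s)).
  congr #|pred_of_set _|; apply/setP => y.
  rewrite -[y](permKV s) mem_imset ?inE; last exact: perm_inj.
  by rewrite (can2_eq (@unshiftK N') (@shiftK N')).
have itE x : itin_word N' s j x = L x.
  apply/ffunP => i; rewrite ffunE /itin.
  have -> : L x i = letter (L x) i by rewrite /letter modn_small ?ltn_ord // inord_val.
  rewrite -last_L -first_unshift -L_shift.
  have -> : letter (L x) i = letter (iter i (@shift N') (L x)) 0.
    by rewrite letter_iter_shift addn0.
  congr letter; elim: (nat_of_ord i) => [|r IHr]; first by rewrite perm1.
  by rewrite expgSr permM iterS -IHr [in RHS]L_shift unshiftK.
exists (s, j); first by rewrite inE.
by move=> t; rewrite /mult -L_cnt; apply: eq_card => x; rewrite !inE itE.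
Qed.

End Realization.

(** * The recurrence *)

Section Multiplicities.

Variables (N' K : nat).
Local Notation N := N'.+1.
Local Notation word := (word N').
Local Notation mfun := {ffun word -> 'I_K.+1}.

(** Values are bounded by [K] to get a finite type; nothing is lost for totals [p <= K]. *)
Definition mfuns (p : nat) : {set mfun} :=
  [set m : mfun | [forall t, m (shift t) == m t] && (\sum_t m t == p)].

Lemma mfunsP p (m : mfun) :
  reflect ((forall t, m (shift t) = m t) /\ \sum_t m t = p) (m \in mfuns p).
Proof.
rewrite inE; apply: (iffP andP) => [[/forallP H /eqP S]|[H ->]]; split=> //.
  by move=> t; apply/eqP.
by apply/forallP => t; rewrite H.
Qed.

Definition mfun_of (f : word -> nat) : mfun := [ffun t => inord (f t)].

Lemma mfun_ofE f p t : \sum_t f t = p -> p <= K -> mfun_of f t = f t :> nat.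
Proof.
move=> <- pK; rewrite ffunE inordK // ltnS; apply: leq_trans pK.
by rewrite (bigD1 t) //= leq_addr.
Qed.

Lemma mfun_of_mem f p : (forall t, f (shift t) = f t) -> \sum_t f t = p -> p <= K ->
  mfun_of f \in mfuns p.
Proof.
move=> f_inv f_sum pK; apply/mfunsP; split.
  by move=> t; apply/val_inj; rewrite /= !(mfun_ofE _ f_sum).
by rewrite -f_sum; apply: eq_bigr => t _; rewrite (mfun_ofE _ f_sum).
Qed.

Lemma card_mfuns_cuts p (Q : pred mfun) : p <= K -> (forall s : 'S_p, (s ^+ N)%g = 1%g) ->
  #|[set m in mfuns p | Q m]| =
  #|[set X in cuts p | Q (mfun_of (mult X.1 X.2))]|.
Proof.
move=> pK sN.
have mE (X : 'S_p * 'I_p.+1) t : mfun_of (mult X.1 X.2) t = mult X.1 X.2 t :> nat.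
  exact: mfun_ofE (sum_mult _ _ _) pK.
pose F (X : 'S_p * 'I_p.+1) := mfun_of (mult X.1 X.2).
rewrite -(card_in_imset (f := F)); last first.
  move=> X Y; rewrite inE => /andP[cX _]; rewrite inE => /andP[cY _] XY.
  by apply: (mult_inj cX cY sN) => t; rewrite -!mE -!/(F _) XY.
apply: eq_card => m; rewrite inE; apply/andP/imsetP => [[/mfunsP[m_inv m_sum] Qm]|].
  have [|X cX XE] := mult_surj (f := fun t => m t : nat) _ m_sum.
    by move=> t; rewrite m_inv.
  have FX : m = F X by apply/ffunP => t; apply/val_inj; rewrite /= mE XE.
  by exists X; rewrite // inE cX -[mfun_of _]/(F X) -FX.
move=> [X]; rewrite inE => /andP[cX QX] ->; split=> //.
by apply: mfun_of_mem (sum_mult _ _ _) pK => t; apply: mult_shift.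
Qed.

(** Adding [f] is inverted by pointwise subtraction, and [p + q <= K] keeps the sums in range. *)
Lemma card_mfuns_add p q (f : word -> nat) (Q : pred mfun) :
    p + q <= K -> (forall t, f (shift t) = f t) -> \sum_t f t = q ->
  #|[set m in mfuns (p + q) | [forall t, f t <= m t] && Q m]| =
  #|[set m in mfuns p | Q (mfun_of (fun t => m t + f t))]|.
Proof.
move=> pqK f_inv f_sum; pose F (m : mfun) := mfun_of (fun t => m t + f t).
have sumF (m : mfun) : m \in mfuns p -> \sum_t (m t + f t) = p + q.
  by move=> /mfunsP[_ m_sum]; rewrite big_split /= m_sum f_sum.
have FE m t : m \in mfuns p -> F m t = m t + f t :> nat.
  by move=> m_p; apply: mfun_ofE (sumF m m_p) pqK.
rewrite -[RHS](card_in_imset (f := F)); last first.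
  move=> m m'; rewrite inE => /andP[mp _]; rewrite inE => /andP[m'p _] E.
  apply/ffunP => t; apply/val_inj/eqP => /=.
  by rewrite -(eqn_add2r (f t)) -!FE // E.
apply: eq_card => m; rewrite inE; apply/andP/imsetP.
  case=> /mfunsP[m_inv m_sum] /andP[/forallP le_f Qm].
  have sum' : \sum_t (m t - f t) = p.
    rewrite sumnB; last by move=> t _; apply: le_f.
    by rewrite m_sum f_sum addnK.
  have pK : p <= K by apply: leq_trans pqK; apply: leq_addr.
  pose m' := mfun_of (fun t => m t - f t).
  have m'p : m' \in mfuns p by apply: mfun_of_mem => // t; rewrite f_inv m_inv.
  have mE : m = F m'.
    by apply/ffunP => t; apply/val_inj; rewrite /= FE // (mfun_ofE _ sum') // subnK.
  by exists m'; rewrite // inE m'p -[mfun_of _]/(F m') -mE.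
move=> [m']; rewrite inE => /andP[m'p Qm'] ->; split.
  apply: mfun_of_mem (sumF _ m'p) pqK => t; rewrite f_inv.
  by have /mfunsP[-> _] := m'p.
by apply/andP; split=> //; apply/forallP => t; rewrite FE // leq_addl.
Qed.

End Multiplicities.

Definition shaped k (d : 'S_k) n : {set 'S_n * 'I_n.+1} :=
  [set X in cuts n | has_cycle_of_shape X.1 d].

Lemma expg_fact n K (s : 'S_n) : n <= K -> (s ^+ K`!)%g = 1%g.
Proof.
move=> nK; apply/eqP; rewrite -order_dvdn (fact_split nK) dvdn_mulr // -card_Sn.
by rewrite -cardsT order_dvdG ?inE.
Qed.

Lemma card_shaped_add k' (d : 'S_k'.+1) n : d \in DeltaCyc k'.+1 ->
  #|shaped d (n + k'.+1)| + #|shaped d n| = 2 ^ n.+1.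
Proof.
set k := k'.+1; rewrite inE => /andP[]; rewrite inE => d_uni d_cyc.
have [jE [jO [jE_k jO_k [cut_E cut_O par_E [par_O cut_EO]]]]] :
  exists jE jO, [/\ jE <= k, jO <= k &
    [/\ cut d jE, cut d jO, ~~ odd (k - jE) &
        odd (k - jO) /\ (forall j, j <= k -> cut d j -> j = jE \/ j = jO)]].
  have [p p_k cutE] := unimodal_two_cuts (ltn0Sn k') d_uni.
  have [cp cp1] : cut d p /\ cut d p.+1.
    by rewrite !cutE ?eqxx ?orbT // ltnW.
  have [odd_p|even_p] := boolP (odd (k - p)).
    exists p.+1, p; split; [exact: p_k|exact: ltnW|split=> //; first by lia].
    by split=> // j jk; rewrite cutE // => /orP[]/eqP; [right|left].
  exists p, p.+1; split; [exact: ltnW|exact: p_k|split=> //].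
  by split=> [|j jk]; [lia|rewrite cutE // => /orP[]/eqP; [left|right]].
(* [K`!] is a common period of all itineraries on at most [K] points. *)
pose K := n + k; pose N' := K`!.-1.
have NE : N'.+1 = K`! by rewrite prednK ?fact_gt0.
have sN p (s : 'S_p) : p <= K -> (s ^+ N'.+1)%g = 1%g by rewrite NE; apply: expg_fact.
have dN : (d ^+ N'.+1)%g = 1%g by apply: sN; rewrite leq_addl.
pose aE := itin_word N' d jE ord0; pose aO := itin_word N' d jO ord0.
pose fE := @mult N' k d jE; pose fO := @mult N' k d jO.
(* [fE] is supported on the shifts of [aE] and constant there, so for invariant [m] this one
   comparison gives [fE <= m] everywhere. *)
pose hasE (m : {ffun word N' -> 'I_K.+1}) := fE aE <= m aE.
pose Q (m : {ffun word N' -> 'I_K.+1}) := hasE m || odd (m aO).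
have shapedE p : p <= K -> #|shaped d p| = #|[set m in mfuns N' K p | Q m]|.
  move=> pK; rewrite card_mfuns_cuts //; last by move=> s; apply: sN.
  apply: eq_card => X; rewrite !inE; case: (boolP (cut _ _)) => //= X_cut.
  have X_sum := @sum_mult N' _ X.1 X.2.
  rewrite /Q /hasE !(mfun_ofE _ X_sum pK).
  apply: (has_shape_mult d_cyc dN jE_k jO_k cut_E cut_O par_E par_O cut_EO X_cut).
  exact: sN.
have nK : n <= K by apply: leq_addr.
rewrite !shapedE //.
rewrite -(cardsID [set m | hasE m] [set m in mfuns N' K (n + k) | Q m]).
(* Subtracting [fE] leaves an arbitrary invariant function of total [n]. *)
have -> : #|[set m in mfuns N' K (n + k) | Q m] :&: [set m | hasE m]| = 2 ^ n.
  transitivity #|[set m in mfuns N' K (n + k) | [forall t, fE t <= m t] && true]|.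
    apply: eq_card => m; rewrite !inE andbT -andbA.
    case: (boolP ([forall t, m (shift t) == m t] && _)) => //= m_in; rewrite /Q.
    have mM : m \in mfuns N' K (n + k) by rewrite inE.
    apply/andP/forallP => [[_ le_m] t|le_m]; last by rewrite /hasE le_m.
    have [->//|/mult_neq0_orbit] := eqVneq (fE t) 0.
    case=> // r ->; rewrite /fE mult_iter_shift // -/fE.
    have -> : m (iter r (@shift N') aE) = m aE.
      by have /mfunsP[m_inv _] := mM; elim: r => //= r <-.
    exact: le_m.
  rewrite card_mfuns_add ?sum_mult // => [|t]; last exact: mult_shift.
  rewrite card_mfuns_cuts // => [|s]; last exact: sN.
  by rewrite -(card_cuts n); apply: eq_card => X; rewrite inE andbT.
(* Adding [fO] raises the value at [aO] by one and keeps the value at [aE], so failure of [Q]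
   becomes odd parity at [aO] with [hasE] still false. *)
have -> : #|[set m in mfuns N' K (n + k) | Q m] :\: [set m | hasE m]| =
          #|mfuns N' K n :\: [set m | Q m]|.
  pose R (m : {ffun word N' -> 'I_K.+1}) := ~~ hasE m && odd (m aO).
  transitivity #|[set m in mfuns N' K (n + k) | [forall t, fO t <= m t] && R m]|.
    apply: eq_card => m; rewrite !inE /Q /R.
    case: (boolP (hasE m)) => /=; rewrite ?andbF // => _.
    case: (boolP ([forall t, m (shift t) == m t] && _)) => //= m_in.
    have mM : m \in mfuns N' K (n + k) by rewrite inE.
    case: (boolP (odd (m aO))) => [odd_m|]; last by rewrite andbF.
    rewrite andbT; symmetry; apply/forallP => t.
    have [->//|/mult_neq0_orbit] := eqVneq (fO t) 0.
    case=> // r ->; rewrite /fO mult_iter_shift // mult_base_odd //.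
    have -> : m (iter r (@shift N') aO) = m aO.
      have /mfunsP[m_inv _] := mM.
      by elim: r => //= r <-.
    by rewrite odd_gt0.
  rewrite card_mfuns_add ?sum_mult // => [|t]; last exact: mult_shift.
  apply: eq_card => m; rewrite !inE [LHS]andbC.
  case: (boolP ([forall t, m (shift t) == m t] && _)) => //= m_in;
    rewrite ?andbF // andbT.
  have mM : m \in mfuns N' K n by rewrite inE.
  have m_sum : \sum_t (m t + fO t) = n + k.
    rewrite big_split /= sum_mult; congr addn.
    by have /mfunsP[] := mM.
  rewrite /R /Q /hasE !(mfun_ofE _ m_sum) // negb_or /fO mult_base_odd //.
  by rewrite mult_base_parity ?par_O ?(negbTE par_E) // addn0 addn1 andbT.
(* The functions of total [n] with and without [Q] add up to all of them. *)
rewrite -addnA [X in _ + X](_ : _ = #|mfuns N' K n|); last first.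
  rewrite addnC -[RHS](cardsID [set m | Q m]); congr (_ + _).
  by apply: eq_card => m; rewrite !inE.
have -> : mfuns N' K n = [set m in mfuns N' K n | true].
  by apply/setP => m; rewrite [RHS]inE andbT.
rewrite card_mfuns_cuts // => [|s]; last exact: sN.
rewrite [X in _ + X](_ : _ = 2 ^ n); first by rewrite addnn -mul2n expnS.
by rewrite -(card_cuts n); apply: eq_card => X; rewrite inE andbT.
Qed.

(** * From pairs to permutations, and the closed formula *)

Lemma card_shaped_DeltaShape k (d : 'S_k) n : 0 < n ->
  #|shaped d n| = 2 * #|DeltaShape d n|.
Proof.
move=> n_gt0; rewrite -sum1_card (partition_big fst (mem (DeltaShape d n))) /=.
  rewrite -sum1_card big_distrr /=; apply: eq_bigr => s.
  rewrite inE => /andP[]; rewrite inE => s_uni s_shape.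
  (* Each permutation is counted twice, once for each side its peak can be put on. *)
  have [p p_n cutE] := unimodal_two_cuts n_gt0 s_uni.
  rewrite sum1dep_card muln1.
  pose a : 'I_n.+1 := inord p; pose b : 'I_n.+1 := inord p.+1.
  have aE : a = p :> nat by rewrite inordK // ltnW.
  have bE : b = p.+1 :> nat by rewrite inordK.
  rewrite -[RHS](_ : #|[set (s, a); (s, b)]| = 2); last first.
    by rewrite cards2 xpair_eqE eqxx -val_eqE /= aE bE ltn_eqF.
  apply: eq_card => -[u j]; rewrite !inE /= !xpair_eqE.
  have [->|] := eqVneq u s; rewrite ?andbF //= andbT s_shape andbT.
  have j_n : j <= n by rewrite -ltnS ltn_ord.
  by rewrite (cutE _ j_n) -[j == a]val_eqE -[j == b]val_eqE /= aE bE.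
move=> [s j]; rewrite !inE /= => /andP[s_cut ->]; rewrite andbT.
by apply: cut_unimodal s_cut => //; rewrite -ltnS.
Qed.

Lemma shaped_small k (d : 'S_k) n : n < k -> #|shaped d n| = 0.
Proof.
move=> nk; apply/eqP; rewrite cards_eq0 -subset0; apply/subsetP => X.
rewrite !inE => /andP[_ /existsP[J /andP[_ /eqP/(congr1 (@tag _ _)) /= JE]]].
have : #|J| <= n by rewrite -[n in _ <= n]card_ord max_card.
by rewrite JE leqNgt nk.
Qed.

Import Order.TTheory GRing.Theory Num.Theory.
Local Open Scope ring_scope.

(** Induction in steps of [k'.+1]; both sides vanish below it. Counting pairs makes sense at [n = 0]
    too, where the descent ends when [k'.+1] divides [n]. *)
Lemma card_shaped k' (d : 'S_k'.+1) n : d \in DeltaCyc k'.+1 ->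
  (2 ^+ k'.+1 + 1) * #|shaped d n|%:R =
    2 * (2 ^+ n - 2 ^+ (n %% k'.+1)%N * (-1) ^+ (n %/ k'.+1)%N) :> rat.
Proof.
move=> d_cyc; elim/ltn_ind: n => n IHn; have [n_k|k_n] := ltnP n k'.+1.
  by rewrite shaped_small // modn_small // divn_small // mulr1 subrr !mulr0.
have {k_n} nE := esym (subnK k_n); move: (n - _)%N nE => m nE in IHn *; subst n.
have rec := card_shaped_add m d_cyc.
have := IHn m; rewrite -[X in (X < _)%N]addn0 ltn_add2l => /(_ isT).
rewrite modnDr divnDr ?dvdnn // divnn /= addn1 exprD (exprS (-1)).
move/(congr1 (fun m => m%:R : rat)): rec; rewrite natrD natrX exprS.
move: (2 ^+ m) ((-1) ^+ _) (2 ^+ (m %% _)) (2 ^+ k'.+1) => u v w c.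
move: #|_|%:R #|_|%:R => y x xy yE.
have -> : x = 2 * u - y by rewrite -xy addrK.
by rewrite mulrBr yE; ring.
Qed.

Theorem mainTheorem2 (k : nat) (k_ge1 : (1 <= k)%N)
    (d : 'S_k) (d_cyc : d \in DeltaCyc k)
    (n : nat) (n_ge1 : (1 <= n)%N)
    (l : nat) (l_lt_k : (l < k)%N) (n_mod_k : n = l %[mod k]) :
  #|DeltaShape d n|%:R =
    1 / (2 ^+ k + 1) * (2 ^+ n - 2 ^+ l * (-1) ^+ (n %/ k)%N) :> rat.
Proof.
case: k k_ge1 d d_cyc l_lt_k n_mod_k => // k' _ d d_cyc l_k n_l.
have := card_shaped n d_cyc.
rewrite card_shaped_DeltaShape // natrM n_l modn_small // mulrCA.
have two_neq0 : 2 != 0 :> rat by [].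
move/(mulfI two_neq0) => <-.
have pos : 2 ^+ k'.+1 + 1 != 0 :> rat by rewrite gt_eqF // addr_gt0 // exprn_gt0.
by rewrite mul1r mulKf.
Qed.
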